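(* Let $\sigma>0$, $\alpha>0$, and let $X, Y$ be independent random variables each with the generalized normal distribution $GND(0,\sigma,\alpha)$, i.e. with density $p(x) = \frac{\alpha\Lambda}{2\Gamma(1/\alpha)} e^{-\Lambda^\alpha |x|^\alpha}$, where $\Lambda = \frac{1}{\sigma}\sqrt{\Gamma(3/\alpha)/\Gamma(1/\alpha)}$. Then $Z = XY$ has density $$f_Z(z) = \frac{\alpha \Lambda^2}{\Gamma(1/\alpha)^2}\, K_0\!\left(2\Lambda^\alpha |z|^{\alpha/2}\right), \qquad z \neq 0.$$
   Context: $K_0$ is the modified Bessel function of the second kind of order $0$; $\Gamma$ is the Euler Gamma function. The distribution of $Z$ is called PGND$(\alpha,\sigma)$. *)

(* Defs.v *)
From HB Require Import structures.
From mathcomp Require Import all_boot all_order all_algebra.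
From mathcomp Require Import all_classical all_reals all_analysis.
Set Implicit Arguments. Unset Strict Implicit. Unset Printing Implicit Defensive.
Import Order.TTheory GRing.Theory Num.Theory.
Import numFieldNormedType.Exports.
Local Open Scope classical_set_scope.
Local Open Scope ring_scope.

Section Defs.
Variable R : realType.

Definition Gamma (s : R) : R :=
  \int[lebesgue_measure]_(t in `]0, +oo[) (t `^ (s - 1) * expR (- t)).

Definition cosh (t : R) : R := (expR t + expR (- t)) / 2.
Definition BesselK0 (x : R) : R :=
  \int[lebesgue_measure]_(t in `[0, +oo[) expR (- (x * cosh t)).

Definition gnd_Lambda (sigma alpha : R) : R :=
  sigma^-1 * Num.sqrt (Gamma (3 / alpha) / Gamma (1 / alpha)).

Definition gnd_pdf (sigma alpha : R) (x : R) : R :=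
  let L := gnd_Lambda sigma alpha in
  alpha * L / (2 * Gamma (1 / alpha)) * expR (- (L `^ alpha * `|x| `^ alpha)).

Definition pgnd_pdf (sigma alpha : R) (z : R) : R :=
  let L := gnd_Lambda sigma alpha in
  alpha * L ^+ 2 / Gamma (1 / alpha) ^+ 2 *
  BesselK0 (2 * L `^ alpha * `|z| `^ (alpha / 2)).

End Defs.

Definition indep_RV2 d (T : measurableType d) (R : realType)
  (P : probability T R) (X Y : T -> R) : Prop :=
  forall A B : set R, measurable A -> measurable B ->
    P (X @^-1` A `&` Y @^-1` B) = (P (X @^-1` A) * P (Y @^-1` B))%E.

Definition has_density d (T : measurableType d) (R : realType)
  (P : probability T R) (X : T -> R) (p : R -> R) : Prop :=
  forall A : set R, measurable A ->
    P (X @^-1` A) = (\int[lebesgue_measure]_(x in A) (p x)%:E)%E.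

(* Main.v *)
(** Conditioning on [X], the product [XY] has density
    [z |-> \int p x * p (z / x) / `|x| dx] at every [z != 0] (Tonelli and the
    scaling of Lebesgue measure).  For the generalized normal density the
    integrand is even in [x], and the substitution
    [x = `|z| `^ (1/2) * expR (v / alpha)], for which [dx / x = dv / alpha],
    makes [`|x| `^ alpha + `|z / x| `^ alpha] equal to
    [2 * `|z| `^ (alpha / 2) * cosh v]: the integral becomes the one defining
    [K_0]. *)

Require Import Defs.
From HB Require Import structures.
From mathcomp Require Import all_boot all_order all_algebra.
From mathcomp Require Import all_classical all_reals all_analysis.
From mathcomp Require Import measurable_realfun.
From mathcomp Require Import ring.
Import Order.TTheory GRing.Theory Num.Theory.
Import numFieldNormedType.Exports.
Local Open Scope classical_set_scope.
Local Open Scope ring_scope.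

(** * Measures given by a density, and changes of variables *)

Section density.
Context {d : measure_display} {T : measurableType d} {R : realType}.
Variables (mu : {measure set T -> \bar R}) (f : T -> R).
Hypotheses (f0 : forall x, 0 <= f x) (mf : measurable_fun setT f).
Local Open Scope ereal_scope.

Let nu A := \int[mu]_(x in A) (f x)%:E.

Let nu0 : nu set0 = 0. Proof. exact: integral_set0. Qed.

Let nu_ge0 A : 0 <= nu A.
Proof. by apply: integral_ge0 => x _; rewrite lee_fin. Qed.

Let nu_sigma_additive : semi_sigma_additive nu.
Proof.
move=> /= F mF tF mUF; rewrite /nu ge0_integral_bigcup//=.
- by apply: is_cvg_ereal_nneg_natsum_cond => n _ _; exact: nu_ge0.
- exact/measurable_EFinP/measurable_funTS.
- by move=> x _; rewrite lee_fin.
Qed.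

HB.instance Definition _ := isMeasure.Build _ _ _ nu
  nu0 nu_ge0 nu_sigma_additive.

(** Additivity over disjoint unions comes from nonnegativity of [f]. Having a bundled measure allows
    it to be pushed forward and compared with Lebesgue measure. *)
Lemma density_measure_exists : exists m : {measure set T -> \bar R},
  forall A, m A = \int[mu]_(x in A) (f x)%:E.
Proof. by exists nu. Qed.

End density.

Import HBNNSimple.

(** For an indicator this is the hypothesis on sets. Linearity extends it to simple functions, and
    monotone convergence to [g]. *)
Lemma ge0_integral_density {d : measure_display} {T : measurableType d}
    {R : realType} (mu nu : {measure set T -> \bar R}) (f : T -> R) :
  (forall x, 0 <= f x) -> measurable_fun setT f ->
  (forall A, measurable A -> nu A = \int[mu]_(x in A) (f x)%:E)%E ->
  forall g : T -> \bar R, (forall x, 0 <= g x)%E -> measurable_fun setT g ->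
  (\int[nu]_x g x = \int[mu]_x (g x * (f x)%:E))%E.
Proof.
move=> f0 mf nuE g g0 mg.
pose h := nnsfun_approx measurableT mg.
have hg x : EFin (h n x) @[n --> \oo] --> g x.
  by apply: cvg_nnsfun_approx.
have ndh x : {homo (fun n => h n x) : m n / (m <= n)%N >-> (m <= n)%R}.
  by move=> m n mn; exact/lefP/nd_nnsfun_approx.
have mhf n : measurable_fun setT (fun x => (h n x * f x)%:E).
  by apply/measurable_EFinP; exact: measurable_funM.
transitivity (limn (fun n => \int[nu]_x (h n x)%:E)%E).
  rewrite -monotone_convergence//.
  - by apply: eq_integral => x _; apply/esym/cvg_lim.
  - by move=> n; exact/measurable_EFinP.
  - by move=> n x _; rewrite lee_fin.
  - by move=> x _ m n mn; rewrite lee_fin; exact: ndh.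
transitivity (limn (fun n => \int[mu]_x (h n x * f x)%:E)%E); last first.
  rewrite -monotone_convergence//.
  - apply: eq_integral => x _; apply/cvg_lim => //.
    under eq_cvg do rewrite EFinM.
    exact: cvgeZr.
  - by move=> n x _; rewrite lee_fin mulr_ge0.
  - by move=> x _ m n mn; rewrite lee_fin ler_wpM2r//; exact: ndh.
(* For a fixed [n], [h n] is a finite sum of multiples of indicators of its fibres, and each fibre
   is settled by [nuE]. *)
congr (limn _); apply/funext => n.
under eq_integral do rewrite fimfunE -fsumEFin//.
rewrite ge0_integral_fsum//; last 2 first.
- by move=> y; exact/measurable_EFinP/measurable_funM.
- by move=> y x _; exact: nnfun_muleindic_ge0.
under [RHS]eq_integral => x _.
  rewrite EFinM fimfunE -fsumEFin// ge0_mule_fsuml; last first.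
    by move=> r; exact: nnfun_muleindic_ge0.
  over.
rewrite ge0_integral_fsum//; last 2 first.
- by move=> y; apply: emeasurable_funM; apply/measurable_EFinP => //;
    exact: measurable_funM.
- by move=> y x _; apply: mule_ge0;
    [exact: nnfun_muleindic_ge0|rewrite lee_fin].
apply: eq_fsbigr => r /[!inE] -[t _ <-].
rewrite integralZl_indic_nnsfun// integral_indic// setIT nuE//.
under [RHS]eq_integral do rewrite EFinM -muleA.
rewrite ge0_integralZl//; last 3 first.
- by apply: emeasurable_funM; apply/measurable_EFinP.
- by move=> x _; rewrite mule_ge0 ?lee_fin.
- by rewrite lee_fin.
congr (_ * _)%E; rewrite integral_mkcond; apply: eq_integral => x _.
by rewrite patchE indicE; case: ifPn => _; rewrite ?mul1e ?mul0e.
Qed.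

(* It suffices to test the change of variables on half-open intervals: the
   measure of density [w], pushed forward by [phi], is then Lebesgue measure. *)
Lemma lebesgue_pushforward_density {R : realType} (phi w : R -> R) :
  measurable_fun setT phi -> measurable_fun setT w -> (forall x, 0 <= w x) ->
  (forall a b : R, a < b ->
    (\int[lebesgue_measure]_(x in phi @^-1` `]a, b]) (w x)%:E
     = (b - a)%:E)%E) ->
  forall g : R -> \bar R, (forall x, 0 <= g x)%E -> measurable_fun setT g ->
  (\int[lebesgue_measure]_x g x =
   \int[lebesgue_measure]_x (g (phi x) * (w x)%:E))%E.
Proof.
move=> mphi mw w0 phiw g g0 mg.
have [nu nuE] := density_measure_exists lebesgue_measure w w0 mw.
transitivity (\int[pushforward nu (phi : _ -> measurableTypeR R)]_x g x)%E.
  apply: eq_measure_integral => /= A mA _.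
  apply: lebesgue_measure_unique => //= _ [[a b]] _ <-.
  rewrite /pushforward nuE lebesgue_measure_itv/= lte_fin.
  case: ltP => ab; first by rewrite phiw.
  by rewrite set_itv_ge ?preimage_set0 ?integral_set0// bnd_simp -leNgt.
rewrite ge0_integral_pushforward//= preimage_setT.
apply: (ge0_integral_density lebesgue_measure nu w w0 mw (fun A _ => nuE A)
  (g \o phi)) => [x|]; first exact: g0.
exact: measurableT_comp.
Qed.

Lemma ge0_integral_mul {R : realType} (x : R) (g : R -> \bar R) :
  x != 0 -> (forall z, 0 <= g z)%E -> measurable_fun setT g ->
  (\int[lebesgue_measure]_z g z =
   \int[lebesgue_measure]_y (g (x * y)%R * `|x|%:E))%E.
Proof.
move=> x0 g0 mg.
apply: (lebesgue_pushforward_density ( *%R x) (cst `|x|)) => // [a b ab].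
have nx0 : 0 < `|x| by rewrite normr_gt0.
(* The boolean [c] records the shape: a negative [x] reverses the interval, so its closed end
   becomes the left one ([c = true]). *)
have [c [l [r [-> lr <-]]]] : exists c l r, [/\ *%R x @^-1` `]a, b] =
    [set` Interval (BSide c l) (BSide c r)], l < r & `|x| * (r - l) = b - a].
  have [xlt0|xgt0|/eqP] := ltgtP x 0; last by rewrite (negbTE x0).
  - exists true, (b / x), (a / x); split.
    + apply/seteqP; split => y /=; rewrite !in_itv/= ler_ndivrMr//
        ltr_ndivlMr//; by rewrite andbC (mulrC y).
    + by rewrite ltr_nM2r// invr_lt0.
    + by rewrite ltr0_norm// -mulrBl mulNr mulrCA divff// mulr1 opprB.
  - exists false, (a / x), (b / x); split.
    + apply/seteqP; split => y /=; rewrite !in_itv/= ler_pdivlMr//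
        ltr_pdivrMr//; by rewrite (mulrC y).
    + by rewrite ltr_pM2r// invr_gt0.
    + by rewrite gtr0_norm// -mulrBl mulrCA divff// mulr1.
rewrite (eq_integral (cst `|x|%:E))// integral_cst//= lebesgue_measure_itv/=.
rewrite lte_fin lr.
by rewrite -EFinB -EFinM.
Qed.

Lemma measurable_invr {R : realType} (D : set R) :
  measurable_fun D (fun x : R => x^-1).
Proof.
apply: measurable_funTS.
(* Squaring makes the base nonnegative, where the power [-1] is the inverse. At [0] both sides
   vanish, by the convention [0^-1 = 0]. *)
rewrite (_ : (fun x => x^-1) = (fun x : R => x * (x ^+ 2) `^ (-1))).
  apply: measurable_funM => //.
  apply: (measurableT_comp (measurable_powR _)) => //.
apply/funext => x; rewrite powR_inv1 ?sqr_ge0//.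
have [->|x0] := eqVneq x 0; first by rewrite invr0 mul0r.
by rewrite expr2 invfM mulrA divff// mul1r.
Qed.

(** The substitution [v = alpha * ln x - c], with [dv = alpha / x dx], maps the positive half-line
    onto the whole line. *)
Lemma ge0_integral_ln {R : realType} (alpha c : R) (g : R -> \bar R) :
  0 < alpha -> (forall z, 0 <= g z)%E -> measurable_fun setT g ->
  (\int[lebesgue_measure]_z g z =
   \int[lebesgue_measure]_(x in `]0%R, +oo[)
     (g (alpha * ln x - c)%R * (alpha / x)%:E))%E.
Proof.
move=> alpha0 g0 mg.
have itvE (x : R) : (x \in `]0, +oo[%classic) = (0 < x).
  by rewrite mem_setE in_itv/= andbT.
(* Extending the weight by zero removes any influence of the default values of [ln] at [x <= 0]. *)
pose w := (fun x : R => alpha / x) \_ `]0, +oo[.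
have mw : measurable_fun setT w.
  apply/(measurable_restrictT _ _).1 => //.
  exact: measurable_funM (measurable_invr _).
rewrite [RHS]integral_mkcond.
transitivity (\int[lebesgue_measure]_x
    (g (alpha * ln x - c)%R * (w x)%:E))%E; last first.
  apply: eq_integral => x _; rewrite /w !patchE.
  by case: ifPn => //; rewrite mule0.
apply: (lebesgue_pushforward_density (fun x => alpha * ln x - c)) => //.
- apply: measurable_funB => //; apply: measurable_funM => //.
- move=> x; rewrite /w patchE; case: ifPn => //; rewrite itvE => x0.
  by rewrite divr_ge0// ltW.
move=> a b ab.
(* The points sent to [a] and [b] by the substitution. *)
pose A := expR ((a + c) / alpha); pose B := expR ((b + c) / alpha).
have A0 : 0 < A by exact: expR_gt0.
have AB : A < B by rewrite ltr_expR ltr_pM2r ?invr_gt0// ltrD2r.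
transitivity (\int[lebesgue_measure]_(x in `]A, B]) (alpha / x)%:E)%E.
  rewrite integral_mkcond [RHS]integral_mkcond; apply: eq_integral => x _.
  rewrite !patchE /w patchE itvE.
  have -> : (x \in (fun x => alpha * ln x - c) @^-1` `]a, b]) =
      (a < alpha * ln x - c <= b).
    by apply/idP/idP; rewrite inE/= in_itv.
  have -> : (x \in `]A, B]%classic) = (A < x <= B).
    by rewrite mem_setE in_itv.
  have [x0|x0] := ltP 0 x; last first.
    by rewrite [A < x]ltNge (le_trans x0 (ltW A0)); case: ifP.
  rewrite ltrBrDr lerBlDr -[in A < x](lnK x0) -[in x <= B](lnK x0).
  rewrite ltr_expR ler_expR.
  by rewrite ltr_pdivrMr// ler_pdivlMr// (mulrC alpha).
have dln (x : R) : 0 < x -> is_derive x 1 (fun x => alpha * ln x) (alpha / x).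
  move=> x0; have h := is_derive1_ln x0; rewrite -[_ / _]/(alpha *: x^-1).
  exact: is_deriveZ.
have cln (x : R) : 0 < x -> {for x, continuous (fun x => alpha * ln x)}.
  move=> x0; apply: continuousM; first exact: cst_continuous.
  exact: continuous_ln.
have cw (x : R) : 0 < x -> {for x, continuous (fun x : R => alpha / x)}.
  move=> x0; apply: cvgM; first exact: cvg_cst.
  by apply: cvgV => //; rewrite gt_eqF.
rewrite integral_itv_obnd_cbnd; last first.
  by apply/measurable_EFinP; exact: measurable_funM (measurable_invr _).
rewrite (@continuous_FTC2 R (fun x => alpha / x) (fun x => alpha * ln x)) //.
- rewrite /A /B !expRK -EFinB -mulrBr -mulrBl mulrCA divff ?gt_eqF// mulr1.
  by rewrite opprD addrACA subrr addr0.
- apply: continuous_in_subspaceT => x; rewrite inE/= in_itv/= => /andP[Ax _].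
  by apply: cw; exact: lt_le_trans Ax.
- split.
  + move=> x; rewrite in_itv/= => /andP[Ax _].
    by have [] := dln x (lt_trans A0 Ax).
  + by apply: cvg_at_right_filter; exact: cln.
  + by apply: cvg_at_left_filter; apply: cln; exact: lt_trans AB.
- move=> x; rewrite in_itv/= => /andP[Ax _].
  by rewrite derive1E; have [_ ->] := dln x (lt_trans A0 Ax).
Qed.

(** * The integral of [K_0] over the whole line *)

Lemma coshN {R : realType} (t : R) : cosh (- t) = cosh t.
Proof. by rewrite /cosh opprK addrC. Qed.

(** A crude consequence of [1 + t <= expR t], sufficient to dominate the integrand of [K_0] by a
    decaying exponential. *)
Lemma cosh_ge_half {R : realType} (t : R) : t / 2 <= cosh t.
Proof.
rewrite /cosh ler_pM2r ?invr_gt0//; apply: (@le_trans _ _ (expR t)).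
  by apply: le_trans (expR_ge1Dx t); rewrite lerDr.
by rewrite lerDl expR_ge0.
Qed.

Lemma continuous_expR_cosh {R : realType} (x : R) :
  continuous (fun t => expR (- (x * cosh t))).
Proof.
move=> t; apply: continuous_comp; last exact: continuous_expR.
apply: continuousN; apply: continuousM; first exact: cst_continuous.
apply: continuousM; last exact: cst_continuous.
apply: continuousD; first exact: continuous_expR.
apply: continuous_comp; last exact: continuous_expR.
exact: continuousN.
Qed.

Lemma integral_BesselK0 {R : realType} (x : R) : 0 < x ->
  (\int[lebesgue_measure]_t (expR (- (x * cosh t)))%:E =
   (2 * BesselK0 x)%:E)%E.
Proof.
move=> x0.
rewrite ge0_symfun_integralT//; last 2 first.
- exact: continuous_expR_cosh.
- by move=> t /=; rewrite coshN.
(* [BesselK0] is the real part of an extended integral, so the identity requires that integral to be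
   finite. *)
rewrite EFinM /BesselK0 /Rintegral set_itvcy fineK// ge0_fin_numE; last first.
  by apply: integral_ge0 => t _; rewrite lee_fin expR_ge0.
have x20 : 0 < x / 2 by rewrite divr_gt0.
have mK D : measurable_fun D (fun t : R => (expR (- (x * cosh t)))%:E).
  apply: measurable_funTS; apply/measurable_EFinP.
  by apply: continuous_measurable_fun; exact: continuous_expR_cosh.
have mpdf D : measurable_fun D (EFin \o exponential_pdf (x / 2)).
  apply: measurable_funTS; apply/measurable_EFinP.
  exact: measurable_exponential_pdf.
have -> : [set t : R | 0 <= t] = `[0, +oo[%classic by rewrite set_itvcy.
(* The bound [expR (- (x / 2 * t))] is [(x / 2)^-1] times the exponential density of rate [x / 2],
   whose total mass is 1. *)
apply: (@le_lt_trans _ _ (\int[lebesgue_measure]_(t in `[0%R, +oo[)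
    ((x / 2)^-1%:E * (exponential_pdf (x / 2) t)%:E))%E).
  apply: ge0_le_integral => //=.
  - exact: mK.
  - by apply: emeasurable_funM; [exact: measurable_cst|exact: mpdf].
  - move=> t; rewrite in_itv/= andbT => t0.
    rewrite -EFinM lee_fin exponential_pdfE// mulKf ?gt_eqF// ler_expR mulNr.
    by rewrite lerN2 -mulrA ler_pM2l// mulrC cosh_ge_half.
rewrite ge0_integralZl//; last 3 first.
- exact: mpdf.
- by move=> t _; rewrite lee_fin exponential_pdf_ge0// ltW.
- by rewrite lee_fin invr_ge0 ltW.
rewrite lte_mul_pinfty//.
  by rewrite lee_fin invr_ge0 ltW.
apply: (@le_lt_trans _ _ 1%E); last exact: ltry.
rewrite -(integral_exponential_pdf x20); apply: ge0_subset_integral => //.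
  exact: mpdf.
by move=> t _; rewrite lee_fin exponential_pdf_ge0// ltW.
Qed.

(** * Laws with densities and products of independent variables *)

Lemma ge0_integral_has_density {R : realType} {d : measure_display}
    {T : measurableType d} (P : probability T R) (X : {RV P >-> R})
    (p : R -> R) :
  (forall x, 0 <= p x) -> measurable_fun setT p -> has_density P X p ->
  forall g : R -> \bar R, (forall x, 0 <= g x)%E -> measurable_fun setT g ->
  (\int[distribution P X]_x g x = \int[lebesgue_measure]_x (g x * (p x)%:E))%E.
Proof.
move=> p0 mp Xp g g0 mg.
have mX : measurable_fun setT (X : T -> measurableTypeR R).
  exact: (measurable_funP X).
rewrite -(ge0_integral_density lebesgue_measure
  (pushforward P (X : T -> measurableTypeR R)) p p0 mp Xp g g0 mg).
by rewrite !ge0_integral_pushforward.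
Qed.

Lemma measurable_mul_convolution_kernel {R : realType} (p q : R -> R) :
  measurable_fun setT p -> measurable_fun setT q ->
  measurable_fun setT (fun u : R * R => p u.1 * q (u.2 / u.1) / `|u.1|).
Proof.
move=> mp mq; apply: measurable_funM; last first.
  apply: (measurableT_comp (measurable_invr setT)).
  by apply: measurableT_comp => //; exact: measurable_fst.
apply: measurable_funM.
  by apply: measurableT_comp => //; exact: measurable_fst.
apply: (measurableT_comp mq).
apply: measurable_funM; first exact: measurable_snd.
by apply: (measurableT_comp (measurable_invr setT)); exact: measurable_fst.
Qed.

Lemma has_density_mul {R : realType} {d : measure_display}
    {T : measurableType d} (P : probability T R) (X Y : {RV P >-> R})
    (p q : R -> R) :
  (forall x, 0 <= p x) -> measurable_fun setT p ->
  (forall x, 0 <= q x) -> measurable_fun setT q ->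
  indep_RV2 P X Y -> has_density P X p -> has_density P Y q ->
  forall A : set R, measurable A ->
  (P ((fun w => (X w * Y w)%R) @^-1` A) =
   \int[lebesgue_measure]_(z in A) \int[lebesgue_measure]_x
     (p x * q (z / x) / `|x|)%:E)%E.
Proof.
move=> p0 mp q0 mq XY Xp Yq A mA.
pose M (u : R * R) := u.1 * u.2.
have mM : measurable_fun setT M by exact: measurable_funM.
have mMA : measurable (M @^-1` A) by
  rewrite -[X in measurable X]setTI; exact: mM.
(* Here [u] is the pair [(x, z)]. With the indicator of [A] inside the kernel, both variables range
   over the whole line, as Tonelli requires. *)
pose k (u : R * R) := (\1_A u.2 * (p u.1 * q (u.2 / u.1) / `|u.1|))%:E.
have k0 u : (0 <= k u)%E.
  by rewrite lee_fin mulr_ge0// divr_ge0// mulr_ge0.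
have mk : measurable_fun setT k.
  apply/measurable_EFinP; apply: measurable_funM.
    by apply: measurableT_comp => //; exact: measurable_snd.
  exact: measurable_mul_convolution_kernel.
transitivity ((distribution P X \x distribution P Y)%E (M @^-1` A)).
  have mXY : measurable_fun setT (fun w => (X w, Y w)).
    by apply: measurable_fun_pair.
  (* Independence is agreement of the joint law with the product measure on rectangles, which
     determines that measure. *)
  rewrite (@product_measure_unique _ _ _ _ R (distribution P X)
    (distribution P Y) (pushforward P (fun w => (X w, Y w))))//.
rewrite /product_measure1.
rewrite (ge0_integral_has_density P X p p0 mp Xp)//; last first.
  exact: measurable_fun_xsection.
transitivity (\int[lebesgue_measure]_x \int[lebesgue_measure]_z k (x, z))%E.
  apply: ge0_ae_eq_integral => //.
  - apply: emeasurable_funM; last exact/measurable_EFinP.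
    exact: measurable_fun_xsection.
  - exact: (measurable_fun_fubini_tonelli_F (m2 := lebesgue_measure) k mk k0).
  - by move=> x _; rewrite mule_ge0// lee_fin.
  - by move=> x _; apply: integral_ge0.
  (* The substitution [z = x * y] breaks down only at [x = 0], a null set. *)
  exists [set 0]; split; [by []|exact: lebesgue_measure_set1|move=> x /=].
  apply: contra_notP => /eqP x0 _.
  have mqx : measurable_fun setT (fun z : R => q (z / x)).
    by apply: (measurableT_comp mq); exact: measurable_funM.
  transitivity ((\int[lebesgue_measure]_z
      (\1_A z * (q (z / x) / `|x|))%:E) * (p x)%:E)%E.
    (* The Jacobian [|x|] of the scaling cancels the division by [|x|] in the kernel. *)
    congr (_ * _)%E; rewrite (ge0_integral_mul _ _ x0); last 2 first.
    - by move=> z; rewrite lee_fin mulr_ge0// divr_ge0.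
    - apply/measurable_EFinP; apply: measurable_funM => //.
      exact: measurable_funM.
    rewrite /distribution/= /pushforward Yq; last exact: measurable_xsection.
    rewrite integral_mkcond; apply: eq_integral => y _.
    rewrite patchE -EFinM mem_xsection indicE.
    rewrite (_ : ((x, y) \in M @^-1` A) = (x * y \in A)); last first.
      by apply/idP/idP; rewrite !inE.
    case: ifPn => _; last by rewrite !mul0r.
    by rewrite mul1r divfK ?normr_eq0// (mulrC x) mulfK.
  rewrite -ge0_integralZr//; last 3 first.
  - apply/measurable_EFinP; apply: measurable_funM => //.
    exact: measurable_funM.
  - by move=> z _; rewrite lee_fin mulr_ge0// divr_ge0.
  - by rewrite lee_fin.
  apply: eq_integral => z _; rewrite /k/= -EFinM; congr EFin.
  by rewrite -!mulrA; congr (_ * _); rewrite mulrA mulrC.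
apply: etrans (fubini_tonelli (m1 := lebesgue_measure)
  (m2 := lebesgue_measure) k mk k0) _.
rewrite [RHS]integral_mkcond; apply: eq_integral => z _.
rewrite patchE; case: ifPn => zA.
  by apply: eq_integral => x _; rewrite /k/= indicE zA mul1r.
by apply: integral0_eq => x _; rewrite /k/= indicE (negbTE zA) mul0r.
Qed.

(** Reflection carries the complement of the half-line to [[0, +oo[], which differs from it by a
    null point. The open half-line is the domain of the logarithmic substitution. *)
Lemma ge0_even_integralT {R : realType} (f : R -> \bar R) :
  measurable_fun setT f -> (forall x, 0 <= f x)%E ->
  (forall x, f (- x)%R = f x) ->
  (\int[lebesgue_measure]_x f x =
   2%:E * \int[lebesgue_measure]_(x in `]0%R, +oo[) f x)%E.
Proof.
move=> mf f0 fN.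
have mfS D : measurable_fun D f by exact: measurable_funTS.
rewrite -(setUv `]0, +oo[%classic) ge0_integral_setU//=; last 3 first.
- exact: measurableC.
- by rewrite setUv.
- exact/disj_setPCl.
rewrite mule_natl mule2n; congr (_ + _)%E.
rewrite setCitvr integral_itv_obnd_cbnd// ge0_integration_by_substitution0//.
by apply: eq_integral => x _; rewrite fN.
Qed.

(** * The generalized normal density and its product kernel *)

Lemma Gamma_ge0 {R : realType} (s : R) : 0 <= Gamma s.
Proof.
by apply: Rintegral_ge0 => t _; rewrite mulr_ge0 ?powR_ge0 ?expR_ge0.
Qed.

Lemma measurable_gnd_pdf {R : realType} (sigma alpha : R) :
  measurable_fun setT (gnd_pdf sigma alpha).
Proof.
rewrite /gnd_pdf; apply: measurable_funM => //.
apply: measurableT_comp => //; apply: measurableT_comp => //.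
apply: measurable_funM => //.
by apply: (measurableT_comp (measurable_powR _)) => //.
Qed.

Lemma gnd_pdfN {R : realType} (sigma alpha x : R) :
  gnd_pdf sigma alpha (- x) = gnd_pdf sigma alpha x.
Proof. by rewrite /gnd_pdf normrN. Qed.

Section gnd.
Context {R : realType} (sigma alpha : R).
Hypotheses (sigma0 : 0 < sigma) (alpha0 : 0 < alpha).

Lemma gnd_Lambda_ge0 : 0 <= gnd_Lambda sigma alpha.
Proof. by rewrite mulr_ge0 ?invr_ge0 ?sqrtr_ge0// ltW. Qed.

Lemma gnd_pdf_ge0 x : 0 <= gnd_pdf sigma alpha x.
Proof.
apply: mulr_ge0; last exact: expR_ge0.
apply: divr_ge0; apply: mulr_ge0 => //.
- exact: ltW.
- exact: gnd_Lambda_ge0.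
- exact: Gamma_ge0.
Qed.

(* [Lambda = 0] would make the density vanish, against total mass 1; this
   avoids showing that the values of [Gamma] are positive. *)
Lemma gnd_Lambda_gt0 {d : measure_display} {T : measurableType d}
    (P : probability T R) (X : {RV P >-> R}) :
  has_density P X (gnd_pdf sigma alpha) -> 0 < gnd_Lambda sigma alpha.
Proof.
move=> /(_ _ measurableT); rewrite preimage_setT probability_setT => P1.
rewrite lt_neqAle gnd_Lambda_ge0 andbT; apply/eqP => L0.
move: P1; rewrite integral0_eq => [/eqP|x _]; first by rewrite eqe oner_eq0.
by rewrite /gnd_pdf -L0 mulr0 !mul0r.
Qed.

Lemma integral_gnd_pdf_BesselK0 (z : R) :
  0 < gnd_Lambda sigma alpha -> z != 0 ->
  (\int[lebesgue_measure]_x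
     (gnd_pdf sigma alpha x * gnd_pdf sigma alpha (z / x) / `|x|)%:E =
   (pgnd_pdf sigma alpha z)%:E)%E.
Proof.
move=> L0 z0.
have nz0 : 0 < `|z| by rewrite normr_gt0.
have mk : measurable_fun setT (fun x : R =>
    (gnd_pdf sigma alpha x * gnd_pdf sigma alpha (z / x) / `|x|)%:E).
  apply/measurable_EFinP.
  have mp := measurable_gnd_pdf sigma alpha.
  apply: (measurableT_comp (measurable_mul_convolution_kernel _ _ mp mp)
    (g := fun x => (x, z))).
  exact: measurable_pair2.
rewrite ge0_even_integralT//; last 2 first.
- by move=> x; rewrite lee_fin divr_ge0// mulr_ge0// gnd_pdf_ge0.
- by move=> x; rewrite normrN invrN mulrN !gnd_pdfN.
rewrite /pgnd_pdf.
set L := gnd_Lambda sigma alpha in L0 *; set G := Gamma (1 / alpha).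
set w := 2 * L `^ alpha * `|z| `^ (alpha / 2).
have w0 : 0 < w by rewrite !mulr_gt0// powR_gt0.
(* The two normalizing constants, divided by [alpha] to compensate the weight [alpha / x] of the
   substitution. *)
pose c := (alpha * L / (2 * G)) ^+ 2 / alpha.
have c0 : 0 <= c by rewrite divr_ge0 ?sqr_ge0// ltW.
have mcosh : measurable_fun setT (fun v : R => (expR (- (w * cosh v)))%:E).
  apply/measurable_EFinP.
  by apply: continuous_measurable_fun; exact: continuous_expR_cosh.
transitivity (2%:E * \int[lebesgue_measure]_(x in `]0%R, +oo[)
    (c%:E * ((expR (- (w * cosh (alpha * ln x - alpha / 2 * ln `|z|))))%:E *
             (alpha / x)%:E)))%E.
  congr (_ * _)%E; apply: eq_integral => x.
  rewrite mem_setE in_itv/= andbT => x0.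
  rewrite -!EFinM; congr EFin; rewrite /gnd_pdf -/L -/G.
  (* With [u] and [v] as below, the two powers are [expR u] and [expR (2 * v - u)]. Factoring out
     [expR v], which is the power of [|z|] in [w], leaves [2 * cosh (u - v)]. *)
  have -> : w * cosh (alpha * ln x - alpha / 2 * ln `|z|) =
      L `^ alpha * `|x| `^ alpha + L `^ alpha * `|z / x| `^ alpha.
    set u := alpha * ln x; set v := alpha / 2 * ln `|z|.
    have Ez : `|z| `^ (alpha / 2) = expR v by rewrite /powR gt_eqF.
    have Ex : `|x| `^ alpha = expR v * expR (u - v).
      by rewrite (gtr0_norm x0) /powR gt_eqF// -expRD addrC subrK.
    have Ezx : `|z / x| `^ alpha = expR v * expR (- (u - v)).
      rewrite normrM normfV (gtr0_norm x0) /powR gt_eqF ?divr_gt0//.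
      by rewrite ln_div// -expRD; congr expR; rewrite /u /v; field.
    by rewrite /w /cosh Ez Ex Ezx; field.
  rewrite opprD expRD (gtr0_norm x0) /c.
  set k := alpha * L / (2 * G).
  by field; rewrite !gt_eqF.
rewrite ge0_integralZl//; last 2 first.
- apply: measurable_funTS; apply: emeasurable_funM.
    apply: (measurableT_comp mcosh); apply: measurable_funB => //.
    exact: measurable_funM.
  by apply/measurable_EFinP; exact: measurable_funM (measurable_invr _).
- move=> x; rewrite /= in_itv/= andbT => x0.
  by rewrite mule_ge0// lee_fin ?expR_ge0// divr_ge0// ltW.
rewrite -(ge0_integral_ln _ _ (fun v => (expR (- (w * cosh v)))%:E))//.
(* Evenness in [x] and evenness of [cosh] each give a factor 2; together they cancel the 4 in the
   denominator of [c]. *)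
rewrite integral_BesselK0// -!EFinM; congr EFin.
rewrite /c invfM -exprVn; set g := G^-1.
by field; rewrite gt_eqF.
Qed.

End gnd.

Theorem theorem5 (R : realType) (d : measure_display) (T : measurableType d)
  (P : probability T R) (X Y : {RV P >-> R}) (sigma alpha : R) :
  0 < sigma -> 0 < alpha ->
  indep_RV2 P X Y ->
  has_density P X (gnd_pdf sigma alpha) ->
  has_density P Y (gnd_pdf sigma alpha) ->
  has_density P (fun w => X w * Y w)
    (fun z => if z == 0 then 0 else pgnd_pdf sigma alpha z).
Proof.
move=> sigma0 alpha0 XY Xp Yp A mA.
set p := gnd_pdf sigma alpha in Xp Yp.
have mp : measurable_fun setT p by exact: measurable_gnd_pdf.
have p0 x : 0 <= p x by exact: gnd_pdf_ge0.
have L0 := gnd_Lambda_gt0 _ _ sigma0 P X Xp.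
rewrite (has_density_mul P X Y p p p0 mp p0 mp XY Xp Yp A mA).
pose h z := (\int[lebesgue_measure]_x (p x * p (z / x) / `|x|)%:E)%E.
have mh : measurable_fun setT h.
  pose k (u : R * R) := (p u.1 * p (u.2 / u.1) / `|u.1|)%:E.
  have mk : measurable_fun setT k.
    by apply/measurable_EFinP; exact: measurable_mul_convolution_kernel.
  have k0 u : (0 <= k u)%E by rewrite lee_fin divr_ge0// mulr_ge0.
  exact: (measurable_fun_fubini_tonelli_G (m1 := lebesgue_measure) k mk k0).
have hE z : (A `\ 0) z -> h z =
    (if z == 0 then 0 else pgnd_pdf sigma alpha z)%:E.
  by move=> [_ /eqP z0]; rewrite (negbTE z0) -integral_gnd_pdf_BesselK0.
have mA0 : measurable (A `\ 0) by exact: measurableD.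
(* The two densities are compared only off [0], so this null point is removed from both
   integrals. *)
rewrite -[LHS](integral_setD1 (r := 0))//; last exact: measurable_funTS.
rewrite -[RHS](integral_setD1 (r := 0))//; last first.
  (* Measurability of the Bessel expression is inherited from [h], a Tonelli marginal with which it
     agrees off [0]. *)
  apply: (eq_measurable_fun h); last exact: measurable_funTS.
  by move=> z /[!inE]; exact: hE.
by apply: eq_integral => z /[!inE]; exact: hE.
Qed.
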